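(* Let $p\geq 3$ and $k\geq 1$ be integers. Let $\mathcal{G}$ be the class of $K_p$-free graphs of treewidth at most $k$. Then the defective chromatic number of $\mathcal{G}$, the clustered chromatic number of $\mathcal{G}$, and the chromatic number of $\mathcal{G}$ are equal.
   Context: Graphs are finite, simple and undirected. A graph is $K_p$-free if it has no subgraph isomorphic to the complete graph $K_p$. A $k$-colouring of a graph assigns one of at most $k$ colours to each vertex (not necessarily properly). A monochromatic component is a connected component of the subgraph induced by all vertices of a single colour. A colouring has defect $d$ if every monochromatic component has maximum degree at most $d$, and has clustering $c$ if every monochromatic component has at most $c$ vertices. For a graph class $\mathcal{G}$: the chromatic number of $\mathcal{G}$ is $\max\{\chi(G):G\in\mathcal{G}\}$, where $\chi(G)$ is the usual (proper) chromatic number; the defective chromatic number of $\mathcal{G}$ is the minimum integer $k$ for which there exists an integer $d$ such that every graph in $\mathcal{G}$ is $k$-colourable with defect $d$; the clustered chromatic number of $\mathcal{G}$ is the minimum integer $k$ for which there exists an integer $c$ such that every graph in $\mathcal{G}$ is $k$-colourable with clustering $c$. (Each is called unbounded if the relevant maximum or minimum does not exist.) Treewidth is the minimum, over all tree-decompositions, of the maximum bag size minus one. *)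

(* Defs.v *)
From HB Require Import structures.
From mathcomp Require Import all_boot.
From mathcomp Require Import boolp.

Set Implicit Arguments.
Unset Strict Implicit.
Unset Printing Implicit Defensive.

Record sgraph := SGraph {
  vertex :> finType;
  edge : rel vertex;
  edge_sym : symmetric edge;
  edge_irrefl : irreflexive edge }.

Definition complete_rel (p : nat) : rel 'I_p := fun i j => i != j.

Lemma complete_sym (p : nat) : symmetric (@complete_rel p).
Proof. by move=> i j; rewrite /complete_rel eq_sym. Qed.

Lemma complete_irrefl (p : nat) : irreflexive (@complete_rel p).
Proof. by move=> i; rewrite /complete_rel eqxx. Qed.

Definition complete_graph (p : nat) : sgraph :=
  SGraph (@complete_sym p) (@complete_irrefl p).

(* [G] has a (not necessarily induced) subgraph isomorphic to [H]. *)
Definition has_subgraph (H G : sgraph) : Prop :=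
  exists f : H -> G,
    injective f /\ forall x y : H, edge x y -> edge (f x) (f y).

Definition clique_free (p : nat) (G : sgraph) : Prop :=
  ~ has_subgraph (complete_graph p) G.

Definition induced_rel (G : sgraph) (A : {set G}) : rel {x : G | x \in A} :=
  fun x y => edge (val x) (val y).

Lemma induced_sym (G : sgraph) (A : {set G}) : symmetric (@induced_rel G A).
Proof. by move=> x y; apply: edge_sym. Qed.

Lemma induced_irrefl (G : sgraph) (A : {set G}) :
  irreflexive (@induced_rel G A).
Proof. by move=> x; apply: edge_irrefl. Qed.

Definition induced (G : sgraph) (A : {set G}) : sgraph :=
  SGraph (@induced_sym G A) (@induced_irrefl G A).

Definition components (G : sgraph) : {set {set G}} :=
  [set [set y | connect (@edge G) x y] | x : G].

Definition max_degree (G : sgraph) : nat :=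
  \max_(x : G) #|[set y : G | edge x y]|.

(* The graph with no vertices is not connected. *)
Definition connected (G : sgraph) : Prop :=
  0 < #|G| /\ forall x y : G, connect (@edge G) x y.

(* The bound on the size matters: [:: x; y] satisfies [ucycle] whenever [x]
   and [y] are adjacent. *)
Definition acyclic (G : sgraph) : Prop :=
  forall c : seq G, 3 <= size c -> ~ ucycle (@edge G) c.

Definition is_tree (G : sgraph) : Prop := connected G /\ acyclic G.

Record tree_decomposition (G : sgraph) := TreeDecomposition {
  td_tree : sgraph;
  bag : td_tree -> {set G};
  td_treeP : is_tree td_tree;
  (* in particular every vertex lies in some bag *)
  bag_vertex : forall v : G, connected (induced [set t | v \in bag t]);
  bag_edge : forall u v : G, edge u v ->
    exists t : td_tree, u \in bag t /\ v \in bag t }.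

(* Truncated predecessor: only the graph with no vertices is affected, which
   gets width 0 instead of -1. *)
Definition width (G : sgraph) (D : tree_decomposition G) : nat :=
  (\max_(t : td_tree D) #|bag t|).-1.

Lemma complete_graph1_tree : is_tree (complete_graph 1).
Proof.
split; first by split=> [|x y]; rewrite ?card_ord // (ord1 x) (ord1 y) connect0.
case=> [|x [|y c]] //= _ /andP[/andP[]].
by rewrite /complete_rel (ord1 x) (ord1 y).
Qed.

Lemma trivial_bag_vertex (G : sgraph) (v : G) :
  connected (induced [set t : complete_graph 1 | v \in [set: G]]).
Proof.
split; last by move=> x y; have -> : x = y
  by apply: val_inj; rewrite (ord1 (val x)) (ord1 (val y)).
have h : (ord0 : complete_graph 1) \in
  [set t : complete_graph 1 | v \in [set: G]] by rewrite !inE.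
by apply/card_gt0P; exists (exist (fun t => t \in _) _ h).
Qed.

Lemma trivial_bag_edge (G : sgraph) (u v : G) : edge u v ->
  exists t : complete_graph 1, u \in [set: G] /\ v \in [set: G].
Proof. by exists (ord0 : complete_graph 1); rewrite !inE. Qed.

Definition trivial_decomposition (G : sgraph) : tree_decomposition G :=
  TreeDecomposition complete_graph1_tree
    (@trivial_bag_vertex G) (@trivial_bag_edge G).

Lemma width_exists (G : sgraph) :
  exists w : nat, `[< exists D : tree_decomposition G, width D = w >].
Proof.
exists (width (trivial_decomposition G)).
by apply/asboolP; exists (trivial_decomposition G).
Qed.

Definition treewidth (G : sgraph) : nat := ex_minn (width_exists G).

Definition colouring (G : sgraph) (k : nat) := {ffun G -> 'I_k}.

Definition is_proper (G : sgraph) (k : nat) (f : colouring G k) : bool :=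
  [forall x, forall y, edge x y ==> (f x != f y)].

Definition colourable (G : sgraph) (k : nat) : bool :=
  [exists f : colouring G k, is_proper f].

Lemma colourable_exists (G : sgraph) : exists k : nat, colourable G k.
Proof.
exists #|G|; apply/existsP; exists [ffun x => enum_rank x].
apply/forallP => x; apply/forallP => y; apply/implyP; rewrite !ffunE.
by apply: contraTneq => /enum_rank_inj ->; rewrite edge_irrefl.
Qed.

Definition chromatic_number (G : sgraph) : nat :=
  ex_minn (colourable_exists G).

Definition mono (G : sgraph) (k : nat) (f : colouring G k) (i : 'I_k) :
  sgraph := induced [set x | f x == i].

Definition has_defect (G : sgraph) (k : nat) (f : colouring G k) (d : nat) :
  Prop :=
  forall (i : 'I_k) (C : {set mono f i}), C \in components (mono f i) ->
    max_degree (induced C) <= d.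

Definition has_clustering (G : sgraph) (k : nat) (f : colouring G k)
  (c : nat) : Prop :=
  forall (i : 'I_k) (C : {set mono f i}), C \in components (mono f i) ->
    #|C| <= c.

Definition graph_class := sgraph -> Prop.

Definition is_minimum (P : nat -> Prop) (n : nat) : Prop :=
  P n /\ forall m : nat, P m -> n <= m.

Definition is_maximum (P : nat -> Prop) (n : nat) : Prop :=
  P n /\ forall m : nat, P m -> m <= n.

(* The parameters of a class are relations with a natural number, since the
   maximum or minimum need not exist: "unbounded" means that no number is
   related to the class. *)
Definition is_class_chromatic_number (GG : graph_class) (n : nat) : Prop :=
  is_maximum (fun m => exists G : sgraph, GG G /\ chromatic_number G = m) n.

Definition is_defective_chromatic_number (GG : graph_class) (n : nat) : Prop :=
  is_minimum (fun m => exists d : nat, forall G : sgraph, GG G ->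
    exists f : colouring G m, has_defect f d) n.

Definition is_clustered_chromatic_number (GG : graph_class) (n : nat) : Prop :=
  is_minimum (fun m => exists c : nat, forall G : sgraph, GG G ->
    exists f : colouring G m, has_clustering f c) n.

Definition clique_free_treewidth (p k : nat) : graph_class :=
  fun G => clique_free p G /\ treewidth G <= k.

(* Main.v *)
(* Proper colourings have clustering 1, and clustering c implies defect c, so
   it is enough to show that if every graph of the class is m-colourable with
   defect d, then every graph G of the class is properly m-colourable.  A graph
   of treewidth at most k has an order of its vertices in which the earlier
   neighbours of each vertex lie in a set of at most k vertices, these sets
   being cliques of a chordal supergraph.  Let G' be the tree-like blow-up of G
   whose vertices are the sequences (a_1, ..., a_i) of numbers at most d|G|,
   regarded as copies of the i-th vertex of G, a sequence being adjacent to
   those of its prefixes that are copies of neighbours.  G' maps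
   homomorphically to G and inherits the order, so it is in the class.  In a
   colouring of G' of defect d, each chosen prefix excludes at most d of its
   extensions, so a branch along which the colouring is proper can be chosen
   greedily; it is a properly coloured copy of G. *)
Require Import Defs.
From HB Require Import structures.
From mathcomp Require Import all_boot.
From mathcomp Require Import boolp.

Set Implicit Arguments.
Unset Strict Implicit.
Unset Printing Implicit Defensive.

(** * Rooted trees and parent functions *)

(** A simple path from [x] to [y] that avoids this arc has length at least 2, so the edge back to
    [x] closes it to a cycle. The reverse arc may stay: a simple path never returns to [x]. *)
Lemma acyclic_bridge (T : sgraph) (x y : T) : acyclic T -> edge x y ->
  ~~ connect [rel a b : T | edge a b && ~~ ((a == x) && (b == y))] x y.
Proof.
move=> acT xy; apply/negP => /connectP [p0 p0P] defy.
case: (shortenP p0P) defy => p pP Up _ defy.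
apply: (acT (x :: p)).
- case: p pP defy {Up} => [|z [|w p]] //=.
  + by move=> _ e; move: xy; rewrite e edge_irrefl.
  + by move=> h e; move: h; rewrite e !eqxx !andbF.
- rewrite /ucycle Up andbT /= rcons_path -defy edge_sym xy andbT.
  by apply: sub_path pP => a b /andP[].
Qed.

(** [d] is the distance to [r], and [par] picks a neighbour nearer to [r]. Any other edge from [x]
    to a vertex no deeper than [x] could be bypassed through the root. *)
Lemma tree_parent (T : sgraph) : is_tree T ->
  exists (r : T) (par : T -> T) (d : T -> nat),
    (forall x, x != r -> d (par x) < d x) /\
    (forall x y, edge x y ->
      (x != r) && (par x == y) || (y != r) && (par y == x)).
Proof.
case=> [[/card_gt0P [r _] conn] acT].
have dex x : exists n, `[< exists p : seq T,
    [/\ path (@edge T) x p, last x p = r & size p = n] >].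
  have /connectP [p pP defr] := conn x r.
  by exists (size p); apply/asboolP; exists p.
pose d x := ex_minn (dex x).
have dle x p : path (@edge T) x p -> last x p = r -> d x <= size p.
  move=> pP lp; rewrite /d; case: ex_minnP => m _; apply.
  by apply/asboolP; exists p.
have dr : d r = 0 by apply/eqP; rewrite -leqn0; apply: (dle r [::]).
have parex x : x != r -> exists y, edge x y && (d y < d x).
  rewrite {2}/d; case: ex_minnP => m /asboolP [[|y p] [/= + + <-]] _.
    by move=> _ ->; rewrite eqxx.
  by move=> /andP[xy pP] lp _; exists y; rewrite xy ltnS dle.
pose par x := odflt r [pick y | edge x y && (d y < d x)].
have parP x : x != r -> edge x (par x) /\ d (par x) < d x.
  rewrite /par => /parex [y xy]; case: pickP => [z /andP //|/(_ y)].
  by rewrite xy.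
exists r, par, d; split=> [x /parP [] //|].
pose ex x := [rel a b : T | edge a b && ((a != x) && (b != x))].
have ex_csym x : connect_sym (ex x).
  by apply: sym_connect_sym => a b; rewrite /= edge_sym [(_ != x) && _]andbC.
(* Climbing from [z] strictly lowers the depth, so [x] is never met. *)
have to_root x z : z != x -> d z <= d x -> connect (ex x) z r.
  have [n] := ubnP (d z); elim: n z => // n IH z; rewrite ltnS => dn zx dzx.
  have [->|/parP [zp dp]] := eqVneq z r; first exact: connect0.
  have dpx := leq_trans dp dzx.
  have px : par z != x by apply: contraTneq dpx => ->; rewrite ltnn.
  apply: connect_trans (IH _ (leq_trans dp dn) px (ltnW dpx)).
  by apply: connect1; rewrite /= zp zx.
have lower x y : edge x y -> d y <= d x -> (x != r) && (par x == y).
  move=> xy dyx.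
  have yx : y != x by apply: contraTneq xy => ->; rewrite edge_irrefl.
  have xr : x != r.
    apply/eqP => e; subst x; move: dyx; rewrite dr leqn0 => /eqP dy.
    by have [_] := parP _ yx; rewrite dy.
  rewrite xr /=; apply/negPn/negP => py.
  have [xp dp] := parP _ xr; move: (acyclic_bridge acT xy) => /negP; apply.
  apply: (@connect_trans _ _ (par x)).
    by apply: connect1; rewrite /= xp eqxx.
  have px : par x != x by apply: contraTneq dp => ->; rewrite ltnn.
  have : connect (ex x) (par x) y.
    apply: connect_trans (to_root _ _ px (ltnW dp)) _.
    by rewrite ex_csym to_root.
  apply: connect_sub => a b /= /andP[ab /andP[ax bx]].
  by apply: connect1; rewrite /= ab negb_and ax.
move=> x y xy; case: (leqP (d y) (d x)) => [/(lower _ _ xy) -> //|/ltnW].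
by rewrite edge_sym in xy; move/(lower _ _ xy) => ->; rewrite orbT.
Qed.

Section ParentTree.

Variables (T : finType) (r : T) (par : T -> T) (d : T -> nat).
Hypothesis d_par : forall x, x != r -> d (par x) < d x.

(** The converse direction: parents of decreasing depth define a tree, later used to build a
    decomposition. *)
Definition parent_rel : rel T :=
  fun x y => (x != r) && (par x == y) || (y != r) && (par y == x).

Lemma parent_sym : symmetric parent_rel.
Proof. by move=> x y; rewrite /parent_rel orbC. Qed.

Lemma parent_irrefl : irreflexive parent_rel.
Proof.
move=> x; rewrite /parent_rel orbb; apply/andP => -[/d_par + /eqP e].
by rewrite e ltnn.
Qed.

Definition parent_graph : sgraph := SGraph parent_sym parent_irrefl.

Lemma parent_lower x y : parent_rel x y -> d y <= d x -> par x = y.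
Proof.
case/orP=> [/andP[_ /eqP //]|/andP[/d_par + /eqP e]].
by rewrite e ltnNge => /negP.
Qed.

(* Both neighbours, along a cycle, of a vertex of maximal depth would be its
   parent. *)
Lemma parent_graph_tree : is_tree parent_graph.
Proof.
have csym : connect_sym parent_rel := sym_connect_sym parent_sym.
have root x : connect parent_rel x r.
  have [n] := ubnP (d x); elim: n x => // n IH x; rewrite ltnS => dn.
  have [->|xr] := eqVneq x r; first exact: connect0.
  apply: connect_trans (IH (par x) (leq_trans (d_par xr) dn)).
  by apply: connect1; rewrite /parent_rel xr eqxx.
split; first split; first by apply/card_gt0P; exists r.
  by move=> x y; apply: connect_trans (root x) _; rewrite csym.
move=> c sc /andP[cc Uc].
have [x0 x0c] : exists x0, x0 \in c.
  by case: c sc {cc Uc} => // a *; exists a; rewrite mem_head.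
pose x := [arg max_(x > x0 | x \in c) d x].
have [xc xmax] : x \in c /\ forall y, y \in c -> d y <= d x.
  by rewrite /x; case: arg_maxnP.
case: (rot_to xc) => i c' defc.
have [sc' mc'] : size (x :: c') = size c /\ x :: c' =i c.
  by rewrite -defc size_rot; split=> // y; rewrite mem_rot.
have cc' : cycle parent_rel (x :: c') by rewrite -defc rot_cycle.
have Uc' : uniq (x :: c') by rewrite -defc rot_uniq.
case: c' {defc} sc' mc' cc' Uc' => [|y c1] sc'; first by move: sc; rewrite -sc'.
case: (lastP c1) sc' => [|c2 z] sc' mc'; first by move: sc; rewrite -sc'.
rewrite /= !rcons_path last_rcons /= => /andP[xy /andP[_ zx]] /and3P[_ yc _].
have py : par x = y.
  by apply: parent_lower xy _; rewrite xmax // -mc' !inE eqxx orbT.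
have pz : par x = z.
  rewrite parent_sym in zx; apply: parent_lower zx _.
  by rewrite xmax // -mc' !inE mem_rcons mem_head !orbT.
by move: yc; rewrite -py pz mem_rcons mem_head.
Qed.

End ParentTree.

(** If [s] were the root or [par s] lay outside [S], a walk in [S] from [s] could not leave the
    descendants of [s], and among these only [s] has depth at most [d s]. *)
Lemma subtree_parent (T : sgraph) (r : T) (par : T -> T) (d : T -> nat)
    (S : {set T}) (s t : T) :
  (forall x, x != r -> d (par x) < d x) ->
  (forall x y, edge x y -> parent_rel r par x y) ->
  connected (induced S) -> s \in S -> t \in S -> d t <= d s -> s != t ->
  (s != r) && (par s \in S).
Proof.
move=> d_par edge_par [_ conn] sS tS dts st; apply/negPn/negP => nsp.
pose up := [rel a b : T | (a != r) && (par a == b)].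
have dup a p : path up a p -> d (last a p) + size p <= d a.
  elim: p a => [|b p IH] a /=; first by rewrite addn0.
  case/andP=> /andP[/d_par da /eqP defb] /IH; rewrite defb in da *.
  by rewrite addnS => h; apply: leq_ltn_trans h da.
have /connectP [p] := conn (exist _ s sS) (exist _ t tS).
(* Invariant along the walk: its current vertex is a descendant of [s]. *)
have : connect up (val (exist (fun x => x \in S) s sS)) s by apply: connect0.
elim: p (exist _ s sS : {x | x \in S}) => [|y p IH] x /= xs.
  move=> _ e; move: xs; rewrite -e /= => /connectP [p /dup] + defs.
  rewrite -defs => h; have := leq_trans h dts.
  case: p defs {h} => /= [e'|a p _].
    by rewrite e' eqxx in st.
  by rewrite addnS ltnNge leq_addr.
case/andP=> xy; apply: IH.
move/edge_par: xy => /orP[] /andP[nr /eqP e]; last first.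
  by apply: connect_trans xs; apply: connect1; rewrite /= nr e eqxx.
case/connectP: xs => [[|z q]] /=.
  by move=> _ es; case/negP: nsp; rewrite es nr e (valP y).
rewrite e => /andP[/andP[_ /eqP ->] qP] ->; apply/connectP; by exists q.
Qed.

(** * Elimination orders and treewidth *)

Definition in_induced (G : sgraph) (A : {set G}) (x : G) (h : x \in A) :
  induced A := exist (fun y => y \in A) x h.

(** The pairs [u \in back v] are the edges of a chordal supergraph, listed in the reverse of a
    perfect elimination order. Ranks may repeat, as they do for copies of one vertex in the
    blow-up. *)
Record elimination (G : sgraph) (k : nat) (rank : G -> nat)
    (back : G -> {set G}) : Prop := Elimination {
  back_rank : forall u v, u \in back v -> rank u < rank v;
  back_edge : forall u v, edge u v -> (u \in back v) || (v \in back u);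
  back_clique : forall u v w, u \in back v -> w \in back v -> u != w ->
    (u \in back w) || (w \in back u);
  back_card : forall v, #|back v| <= k }.

(** Ties of [h] are broken by [enum_rank], used as the last digit in base [#|T|]. *)
Lemma injective_refinement (T : finType) (h : T -> nat) :
  exists2 g : T -> nat, injective g & forall x y, g x < g y -> h x <= h y.
Proof.
exists (fun x => h x * #|T| + enum_rank x) => [x y /= e|x y /=].
  apply: enum_rank_inj; apply: ord_inj.
  by have := congr1 (modn^~ #|T|) e; rewrite !modnMDl !modn_small.
rewrite [h x <= _]leqNgt; apply: contraL => hyx; rewrite -leqNgt ltnW //.
apply: (@leq_trans ((h y).+1 * #|T|)); first by rewrite mulSn addnC ltn_add2r.
by apply: leq_trans (leq_addr _ _); rewrite leq_mul2r hyx orbT.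
Qed.

Lemma treewidth_decomposition (G : sgraph) (k : nat) :
  treewidth G <= k <-> exists D : tree_decomposition G, width D <= k.
Proof.
rewrite /treewidth; case: ex_minnP => m /asboolP [D wD] min.
split=> [mk|[D' wk]]; first by exists D; rewrite wD.
by apply: leq_trans wk; apply: min; apply/asboolP; exists D'.
Qed.

(* Root the tree and eliminate first the vertices whose highest bag is deepest:
   [back v] is the rest of the highest bag of [v]. *)
Lemma elimination_of_treewidth (G : sgraph) (k : nat) : treewidth G <= k ->
  exists rank back, injective rank /\ @elimination G k rank back.
Proof.
case/treewidth_decomposition => -[T bag tP bagV bagE] /= wk.
case: (tree_parent tP) => r [par [d [d_par edge_par]]].
have inbag v : exists t, v \in bag t.
  have [/card_gt0P [[t tv] _] _] := bagV v.
  by exists t; rewrite inE in tv.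
pose top v := [arg min_(t < xchoose (inbag v) | v \in bag t) d t].
have topP v : v \in bag (top v) /\ forall t, v \in bag t -> d (top v) <= d t.
  rewrite /top; case: arg_minnP => [|t tv tmin]; last by split.
  exact: (xchooseP (inbag v)).
have [rank rank_inj rank_top] := injective_refinement (d \o top).
(* Climbing from [s] keeps both vertices in the bag until [top v] is reached; [top u] is no deeper,
   so [u] is not lost before. *)
have bag_top u v s : u \in bag s -> v \in bag s -> rank u < rank v ->
    u \in bag (top v).
  move=> + + /rank_top /= duv; have [n] := ubnP (d s).
  elim: n s => // n IH s; rewrite ltnS => dn us vs.
  have [<- //|sv] := eqVneq s (top v).
  have [vt vmin] := topP v; have [ut umin] := topP u.
  have key w x : x \in bag s -> x \in bag w -> d w <= d s -> s != w ->
      (s != r) && (x \in bag (par s)).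
    move=> xs xw dw sw.
    have := @subtree_parent T r par d [set t | x \in bag t] s w d_par edge_par.
    by rewrite !inE; apply.
  have /andP [sr vp] := key _ _ vs vt (vmin _ vs) sv.
  have ds := leq_trans (d_par _ sr) dn.
  have su : s != top u.
    apply: contraTneq (d_par _ sr) => e; rewrite -leqNgt [X in d X <= _]e.
    exact: leq_trans duv (vmin _ vp).
  have /andP [_ up] := key _ _ us ut (umin _ us) su.
  exact: IH ds up vp.
pose back v := [set u in bag (top v) | rank u < rank v].
have share u v s : u \in bag s -> v \in bag s -> u != v ->
    (u \in back v) || (v \in back u).
  move=> us vs uv; rewrite !inE.
  case: (ltngtP (rank u) (rank v)) => [h|h|/rank_inj e].
  - by rewrite (bag_top _ _ _ us vs h).
  - by rewrite (bag_top _ _ _ vs us h) orbT.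
  - by rewrite e eqxx in uv.
exists rank, back; split=> //; split.
- by move=> u v; rewrite inE => /andP[].
- move=> u v uv; have [t [ut vt]] := bagE _ _ uv; apply: (share _ _ t) => //.
  by apply: contraTneq uv => ->; rewrite edge_irrefl.
- move=> u v w; rewrite inE => /andP[us _]; rewrite inE => /andP[ws _].
  exact: share us ws.
- move=> v; have [vt _] := topP v.
  (* The bag also contains [v], which accounts for the predecessor in [width]. *)
  have : #|v |: back v| <= #|bag (top v)|.
    apply/subset_leq_card/subsetP => u; rewrite !inE.
    by case/orP => [/eqP -> //|/andP[]].
  rewrite cardsU1 inE ltnn andbF add1n => h.
  rewrite -ltnS; apply: leq_trans h _; apply: leq_trans (_ : _ <= (width
    (TreeDecomposition tP bagV bagE)).+1) _; last by rewrite ltnS.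
  apply: leq_trans (leqSpred _).
  exact: (leq_bigmax (F := fun t => #|bag t|)).
Qed.

(** The node [Some v] has bag [v |: back v], and its parent is the last vertex of [back v]. The root
    [None], with an empty bag, joins the pieces of a disconnected graph and serves the empty
    graph. *)
Lemma treewidth_of_elimination (G : sgraph) (k : nat) rank back :
  @elimination G k rank back -> treewidth G <= k.
Proof.
case=> b_rank b_edge b_clique b_card; apply/treewidth_decomposition.
pose par (o : option G) := if o is Some v then
  [pick m in back v | [forall u in back v, rank u <= rank m]] else None.
pose d (o : option G) := if o is Some v then (rank v).+1 else 0.
pose bag (o : option G) := if o is Some v then v |: back v else set0.
(* The clique condition puts the rest of [back v] into [back m], because [m] has the largest rank
   there. *)
have parP v u : u \in back v -> exists m, [/\ par (Some v) = Some m,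
    m \in back v & (u == m) || (u \in back m)].
  move=> uv; rewrite /par; case: pickP => [m /andP[mv /forall_inP mmax]|].
    exists m; split=> //; have [//|um] := eqVneq u m.
    have /orP [//|/b_rank] := b_clique _ _ _ uv mv um.
    by rewrite ltnNge mmax.
  have [m mv mmax] := arg_maxnP rank uv.
  by move/(_ m); rewrite (mv : m \in back v) => /forall_inP; case.
have d_par o : o != None -> d (par o) < d o.
  case: o => //= v _; case: pickP => //= m /andP[/b_rank + _].
  by rewrite ltnS.
have bagV v : connected (induced [set t : parent_graph d_par | v \in bag t]).
  pose S : {set parent_graph d_par} := [set t | v \in bag t].
  rewrite -/S; have Sv : (Some v : parent_graph d_par) \in S.
    by rewrite !inE eqxx.
  split; first by apply/card_gt0P; exists (in_induced Sv).
  have csym : connect_sym (@edge (induced S)).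
    by apply: sym_connect_sym; apply: edge_sym.
  (* From any node whose bag contains [v], the parents lead to [Some v] through such nodes. *)
  have center x : connect (@edge (induced S)) x (in_induced Sv).
    have [n] := ubnP (d (val x)); elim: n x => // n IH x; rewrite ltnS => dn.
    have [e|xv] := eqVneq (val x) (Some v).
      by rewrite (_ : x = in_induced Sv) ?connect0 //; apply: val_inj.
    case: x dn xv => -[w|] xS dn xv; last by exfalso; move: (xS); rewrite !inE.
    have vw : v \in back w.
      move: (xS); rewrite !inE => /orP[/eqP e|//].
      by rewrite /= e eqxx in xv.
    have [m [pw mw vm]] := parP _ _ vw.
    have mS : (Some m : parent_graph d_par) \in S by rewrite !inE.
    apply: connect_trans (IH (in_induced mS) _).
      by apply: connect1; rewrite /= /induced_rel /= /parent_rel pw eqxx.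
    by apply: leq_trans dn; rewrite /= ltnS b_rank.
  by move=> x y; apply: connect_trans (center x) _; rewrite csym.
have bagE u v : edge u v -> exists t : parent_graph d_par,
    u \in bag t /\ v \in bag t.
  case/b_edge/orP => h; [exists (Some v) | exists (Some u)];
    by rewrite !inE h eqxx ?orbT.
exists (TreeDecomposition (parent_graph_tree d_par) bagV bagE).
rewrite /width /=; case: (posnP (\max_t #|bag t|)) => [-> //|h].
rewrite -ltnS prednK //; apply/bigmax_leqP => -[v|] _ /=;
  last by rewrite cards0.
by rewrite cardsU1 -add1n leq_add // leq_b1.
Qed.

(** Greedy colouring by rank: [back v] blocks at most [k] of the [k.+1] colours. This bounds the
    chromatic numbers in the class, so that their maximum exists. *)
Lemma elimination_colourable (G : sgraph) (k : nat) rank back :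
  @elimination G k rank back -> colourable G k.+1.
Proof.
case=> b_rank b_edge _ b_card.
have step n : exists f : colouring G k.+1, forall u v,
    rank v < n -> u \in back v -> f u != f v.
  elim: n => [|n [f fP]]; first by exists [ffun=> ord0].
  have free v : exists c : 'I_k.+1, c \notin f @: back v.
    apply/existsP; rewrite -negb_forall; apply/negP => /forallP all_in.
    have : #|'I_k.+1| <= #|f @: back v|.
      by apply/subset_leq_card/subsetP => c _; apply: all_in.
    rewrite card_ord leqNgt ltnS => /negP; apply.
    exact: leq_trans (leq_imset_card _ _) (b_card v).
  exists [ffun v => if rank v == n then xchoose (free v) else f v] => u v.
  rewrite !ffunE ltnS leq_eqVlt => /orP[/eqP e|vn] uv.
    have := b_rank _ _ uv; rewrite e eqxx ltn_neqAle => /andP[/negPf -> _].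
    apply: contraNneq (xchooseP (free v)) => <-; exact: imset_f.
  have un := ltn_trans (b_rank _ _ uv) vn.
  by rewrite !ltn_eqF // fP.
have [f fP] := step (\max_v rank v).+1.
have fP' u v : u \in back v -> f u != f v by apply: fP; rewrite ltnS leq_bigmax.
apply/existsP; exists f; apply/forallP => x; apply/forallP => y; apply/implyP.
by case/b_edge/orP => /fP' //; rewrite eq_sym.
Qed.

(** * The tree-like blow-up *)

Section Blowup.

Variables (G : sgraph) (rank : G -> nat) (N : nat).

Definition agree (i : nat) (a b : {ffun G -> 'I_N.+1}) : bool :=
  [forall u, (rank u <= i) ==> (a u == b u)].

(* A copy of [v] records one choice in ['I_N.+1] for each vertex of rank at
   most [rank v]; the other values of the function are [ord0]. *)
Definition is_copy (x : G * {ffun G -> 'I_N.+1}) : bool :=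
  [forall u, (rank x.1 < rank u) ==> (x.2 u == ord0)].

Definition copy : finType := {x | is_copy x}.

Definition base (x : copy) : G := (val x).1.
Definition choices (x : copy) : {ffun G -> 'I_N.+1} := (val x).2.

Lemma is_copy_truncation (v : G) (a : {ffun G -> 'I_N.+1}) :
  is_copy (v, [ffun u => if rank u <= rank v then a u else ord0]).
Proof.
by apply/forallP => u; apply/implyP; rewrite /= ffunE ltnNge => /negPf ->.
Qed.

Definition copy_along (v : G) (a : {ffun G -> 'I_N.+1}) : copy :=
  exist is_copy _ (is_copy_truncation v a).

Lemma choices_copy_along v (a : {ffun G -> 'I_N.+1}) u : rank u <= rank v ->
  choices (copy_along v a) u = a u.
Proof. by move=> uv; rewrite /choices /= ffunE uv. Qed.

Lemma agreeP i (a b : {ffun G -> 'I_N.+1}) :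
  reflect (forall u, rank u <= i -> a u = b u) (agree i a b).
Proof.
apply: (iffP forallP) => [h u ui|h u]; first by apply/eqP/(implyP (h u)).
by apply/implyP => ui; rewrite h.
Qed.

Lemma agree_sym i a b : agree i a b = agree i b a.
Proof. by apply/agreeP/agreeP => h u ui; rewrite h. Qed.

Lemma copy_eq (x y : copy) :
  base x = base y -> agree (rank (base x)) (choices x) (choices y) -> x = y.
Proof.
case: x y => -[v a] xP [[w b] yP]; rewrite /base /choices /= => e.
subst w => /agreeP h; apply: val_inj; congr pair; apply/ffunP => u.
have [/h //|vu] := leqP (rank u) (rank v).
move: xP yP => /forallP /(_ u) /implyP/(_ vu)/eqP -> /forallP /(_ u).
by move/implyP/(_ vu)/eqP => ->.
Qed.

(** Agreement up to the smaller rank says that one sequence is a prefix of the other. *)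
Definition copy_rel : rel copy := fun x y => edge (base x) (base y) &&
  agree (minn (rank (base x)) (rank (base y))) (choices x) (choices y).

Lemma copy_sym : symmetric copy_rel.
Proof. by move=> x y; rewrite /copy_rel edge_sym minnC agree_sym. Qed.

Lemma copy_irrefl : irreflexive copy_rel.
Proof. by move=> x; rewrite /copy_rel edge_irrefl. Qed.

Definition blowup : sgraph := SGraph copy_sym copy_irrefl.

Lemma copy_along_edge u v a : edge u v ->
  @edge blowup (copy_along u a) (copy_along v a).
Proof.
move=> uv; rewrite /= /copy_rel uv; apply/agreeP => w.
by rewrite leq_min => /andP[wu wv]; rewrite !choices_copy_along.
Qed.

(** [base] is a homomorphism, and a homomorphism from a complete graph to a loopless graph is
    injective. *)
Lemma blowup_clique_free p : clique_free p G -> clique_free p blowup.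
Proof.
move=> free [f [_ f_edge]]; apply: free; exists (base \o f).
have hom x y : @edge (complete_graph p) x y -> edge (base (f x)) (base (f y)).
  by move/f_edge => /andP[].
split=> // x y e; apply/eqP/negPn/negP => /hom.
by rewrite (e : base (f x) = base (f y)) edge_irrefl.
Qed.

(** Earlier neighbours of a copy are prefixes of it, and a prefix is determined by its base. Hence
    [base] is injective on them, and two of them always agree up to the smaller rank. *)
Lemma blowup_elimination k back : @elimination G k rank back ->
  @elimination blowup k (rank \o base) (fun x => [set y : copy |
    (base y \in back (base x)) &&
    agree (rank (base y)) (choices y) (choices x)]).
Proof.
case=> b_rank b_edge b_clique b_card; split.
- by move=> x y; rewrite inE => /andP[/b_rank].
- move=> x y /andP[/b_edge/orP [] h ag]; rewrite !inE h /=.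
    by rewrite (minn_idPl (ltnW (b_rank _ _ h))) in ag; rewrite ag.
  by rewrite (minn_idPr (ltnW (b_rank _ _ h))) agree_sym in ag; rewrite ag orbT.
- have trans (x y z : copy) : rank (base x) <= rank (base y) ->
      agree (rank (base x)) (choices x) (choices z) ->
      agree (rank (base y)) (choices y) (choices z) ->
      agree (rank (base x)) (choices x) (choices y).
    move=> xy /agreeP xz /agreeP yz; apply/agreeP => u ux.
    by rewrite xz // yz // (leq_trans ux).
  move=> y x z; rewrite !inE => /andP[yx ay] /andP[zx az] yz.
  have nbase : base y != base z.
    apply: contraNneq yz => e; apply/eqP/copy_eq => //.
    by apply: trans az => //; rewrite e.
  case/orP: (b_clique _ _ _ yx zx nbase) => h; rewrite h /=.
    by rewrite (trans y z x) // ltnW // b_rank.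
  by rewrite [X in _ || X](trans z y x) ?orbT // ltnW // b_rank.
- move=> x; apply: leq_trans (b_card (base x)).
  rewrite -(card_in_imset (f := base)).
    apply/subset_leq_card/subsetP => _ /imsetP [y + ->].
    by rewrite inE => /andP[].
  move=> y z; rewrite !inE => /andP[_ /agreeP ay] /andP[_ /agreeP az] e.
  by apply: copy_eq => //; apply/agreeP => u uy; rewrite ay // az // -e.
Qed.

End Blowup.

(** * Defect, clustering and colourings of the blow-up *)

(** The neighbours of [x] in its own colour all lie in its monochromatic component, so defect
    becomes a local bound free of nested subtypes. *)
Lemma mono_neighbours (G : sgraph) m (f : colouring G m) d (x : G) :
  has_defect f d -> #|[set y | edge x y && (f y == f x)]| <= d.
Proof.
move=> fd; have xM : x \in [set y | f y == f x] by rewrite inE.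
pose X : mono f (f x) := in_induced xM.
pose C := [set Y | connect (@edge (mono f (f x))) X Y].
have XC : X \in C by rewrite inE connect0.
apply: leq_trans (fd (f x) C _); last by apply/imsetP; exists X.
pose X' : induced C := in_induced XC.
apply: leq_trans
  (leq_bigmax (F := fun Z : induced C => #|[set Y | edge Z Y]|) X').
apply: leq_trans (leq_imset_card (fun Z : induced C => val (val Z)) _).
apply/subset_leq_card/subsetP => y; rewrite inE => /andP[xy fy].
have yM : y \in [set y | f y == f x] by rewrite inE.
pose Y : mono f (f x) := in_induced yM.
have YC : Y \in C by rewrite inE; apply: connect1.
by apply/imsetP; exists (in_induced YC); rewrite ?inE.
Qed.

Lemma clustering_defect (G : sgraph) m (f : colouring G m) c :
  has_clustering f c -> has_defect f c.
Proof.
move=> fc i C /fc; apply: leq_trans; apply/bigmax_leqP => x _.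
apply: leq_trans (max_card _) _; rewrite card_sig.
by apply: eq_leq; apply: eq_card.
Qed.

Lemma proper_clustering (G : sgraph) m (f : colouring G m) :
  is_proper f -> has_clustering f 1.
Proof.
move=> fP i C /imsetP [x _ ->]; rewrite -(cards1 x).
apply/subset_leq_card/subsetP => y; rewrite !inE => /connectP [[|z p]] /=.
  by move=> _ ->.
case/andP=> xz _ _; have := valP x; have := valP z; rewrite !inE.
move=> /eqP zi /eqP xi; move/forallP: fP => /(_ (val x))/forallP/(_ (val z)).
by move/implyP/(_ xz); rewrite xi zi eqxx.
Qed.

Lemma blowup_colourable (G : sgraph) (rank : G -> nat) m d
    (f : colouring (blowup rank (d * #|G|)) m) :
  injective rank -> has_defect f d -> colourable G m.
Proof.
move=> rank_inj fd; set N := d * #|G| in f fd *.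
pose col a v := f (copy_along rank v a).
have step n : exists a : {ffun G -> 'I_N.+1}, forall u v,
    edge u v -> rank u < n -> rank v < n -> col a u != col a v.
  elim: n => [|n [a aP]]; first by exists [ffun=> ord0].
  have [[v vn]|none] := pselect (exists v, rank v = n); last first.
    exists a => u v uv; rewrite !ltnS (leq_eqVlt (rank u)) (leq_eqVlt (rank v)).
    case/orP=> [/eqP un|un]; first by case: none; exists u.
    by case/orP=> [/eqP vn|]; [case: none; exists v | apply: aP].
  pose upd j := [ffun u => if u == v then j else a u].
  (* A choice at [v] leaves the copies of earlier vertices unchanged. *)
  have col_upd j u : rank u < n -> col (upd j) u = col a u.
    move=> un; congr (f _); apply: copy_eq => //; apply/agreeP => w wu.
    rewrite !choices_copy_along // ffunE; case: eqVneq => // e.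
    by move: wu; rewrite e vn leqNgt un.
  (* The choices at [v] that [u] excludes. Distinct ones give distinct copies of [v], all adjacent
     to the same copy of [u] and sharing its colour, so the defect bounds their number. *)
  pose bad u := [set j | [&& edge u v, rank u < n & col (upd j) v == col a u]].
  have card_bad u : #|bad u| <= d.
    have [/andP [uv un]|no] := boolP (edge u v && (rank u < n)); last first.
      rewrite (_ : bad u = set0) ?cards0 //; apply/setP => j.
      by rewrite !inE andbA (negPf no).
    apply: leq_trans _
      (mono_neighbours (copy_along rank u a : blowup rank N) fd).
    rewrite -(card_in_imset (f := fun j => copy_along rank v (upd j))).
      apply/subset_leq_card/subsetP => _ /imsetP [j jb ->]; rewrite inE.
      move: jb; rewrite inE => /and3P[_ _ cj].
      rewrite [_ == _]cj andbT.
      have -> : copy_along rank u a = copy_along rank u (upd j).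
        apply: copy_eq => //; apply/agreeP => w wu.
        rewrite !choices_copy_along // ffunE; case: eqVneq => // e.
        by move: wu; rewrite e vn leqNgt un.
      exact: copy_along_edge.
    move=> i j _ _ /(congr1 (fun x => choices x v)).
    by rewrite !choices_copy_along // !ffunE eqxx.
  (* At most [d * #|G|] choices are excluded in total, one fewer than the [N.+1] available. *)
  have [j good] : exists j, j \notin \bigcup_u bad u.
    apply/existsP; rewrite -negb_forall; apply/negP => /forallP all_bad.
    have : #|'I_N.+1| <= #|\bigcup_u bad u|.
      by apply/subset_leq_card/subsetP => j _; apply: all_bad.
    rewrite card_ord leqNgt ltnS => /negP; apply.
    apply: leq_trans (_ : _ <= \sum_u #|bad u|) _.
      elim/big_rec2: _ => [|u s t _ st]; first by rewrite cards0.
      by rewrite (leq_trans (leq_card_setU _ _)) ?leq_add2l.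
    by rewrite [leqRHS]mulnC -sum_nat_const; apply: leq_sum => u _.
  have key u : edge u v -> rank u < n -> col a u != col (upd j) v.
    move=> uv un; apply: contra good => e; apply/bigcupP; exists u => //.
    by rewrite inE uv un eq_sym.
  exists (upd j) => u w uw.
  rewrite !ltnS (leq_eqVlt (rank u)) (leq_eqVlt (rank w)).
  case/orP=> [/eqP un|un] /orP [/eqP wn|wn].
  - by move: uw; rewrite (rank_inj u w) ?edge_irrefl // un.
  - rewrite -vn in un; rewrite (rank_inj _ _ un) in uw *.
    by rewrite eq_sym col_upd // key // edge_sym.
  - rewrite -vn in wn; rewrite (rank_inj _ _ wn) in uw *.
    by rewrite col_upd // key.
  - by rewrite !col_upd // aP.
have [a aP] := step (\max_v rank v).+1.
apply/existsP; exists [ffun v => col a v].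
apply/forallP => x; apply/forallP => y; apply/implyP => xy; rewrite !ffunE.
by apply: aP => //; rewrite ltnS leq_bigmax.
Qed.

(** * Equality of the three parameters *)

Lemma colourable_chromatic (G : sgraph) m :
  colourable G m <-> chromatic_number G <= m.
Proof.
rewrite /chromatic_number; case: ex_minnP => n /existsP [f fP] nmin.
split=> [/nmin //|nm]; apply/existsP; exists [ffun v => widen_ord nm (f v)].
apply/forallP => x; apply/forallP => y; apply/implyP => xy; rewrite !ffunE.
by move/forallP: fP => /(_ x)/forallP/(_ y)/implyP/(_ xy).
Qed.

Theorem theorem13 (p k : nat) (hp : 3 <= p) (hk : 1 <= k) :
  exists n : nat,
    is_defective_chromatic_number (clique_free_treewidth p k) n /\
    is_clustered_chromatic_number (clique_free_treewidth p k) n /\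
    is_class_chromatic_number (clique_free_treewidth p k) n.
Proof.
pose P m := `[< exists G : sgraph,
  clique_free_treewidth p k G /\ chromatic_number G = m >].
have exP : exists m, P m.
  (* The graph without vertices shows that the class is nonempty. *)
  exists (chromatic_number (complete_graph 0)); apply/asboolP.
  exists (complete_graph 0); split=> //; split.
    by case=> f _; case: (f (Ordinal (ltnW (ltnW hp)))).
  apply/treewidth_decomposition; exists (trivial_decomposition _).
  rewrite /width; apply: leq_trans (leq_pred _) _; apply/bigmax_leqP => t _.
  by rewrite (leq_trans (max_card _)) // card_ord.
have ubP m : P m -> m <= k.+1.
  move/asboolP => [G [[_ /elimination_of_treewidth [rank [back [_ el]]]] <-]].
  exact/colourable_chromatic/elimination_colourable/el.
have [n /asboolP nP nmax] := ex_maxnP exP ubP.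
have proper G : clique_free_treewidth p k G ->
    exists f : colouring G n, is_proper f.
  move=> GP; apply/existsP/colourable_chromatic/nmax/asboolP.
  by exists G.
(* The blow-up is taken of a graph [G] attaining the maximum [n], with the size dictated by the
   defect [d]. *)
have lower m d : (forall G, clique_free_treewidth p k G ->
    exists f : colouring G m, has_defect f d) -> n <= m.
  move=> mP; have [G [[free tw] <-]] := nP; apply/colourable_chromatic.
  have [rank [back [rank_inj el]]] := elimination_of_treewidth tw.
  have [|f fd] := mP (blowup rank (d * #|G|)).
    split; first exact: blowup_clique_free.
    exact: treewidth_of_elimination (blowup_elimination _ el).
  exact: blowup_colourable fd.
exists n; split; [|split]; split=> //.
- exists 1 => G /proper [f /proper_clustering fc]; exists f.
  exact: clustering_defect.
- by move=> m [d]; apply: lower.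
- by exists 1 => G /proper [f /proper_clustering fc]; exists f.
- move=> m [c mP]; apply: (lower m c) => G /mP [f fc]; exists f.
  exact: clustering_defect.
- by move=> m mP; apply/nmax/asboolP.
Qed.
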